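(* Let $p$ be a prime and let $e$ be the entry point of the Fibonacci sequence modulo $p$. For $n\ge1$ let $R_n$ be the $n\times n$ matrix with $(i,j)$ entry $\binom{i-1}{n-j}$. Then for every $k\ge1$, \[ R_{2k}^{\,e}\equiv(-1)^{(k+1)e}F_{e-1}\,I_{2k}\pmod p, \] for every $k\ge0$, \[ R_{2k+1}^{\,e}\equiv(-1)^{ke}\,I_{2k+1}\pmod p, \] and for every $n\ge1$, $R_n^{4e}\equiv I_n\pmod p$.
   Context: Convention: $\binom{m}{k}=0$ if $k<0$ or $k>m$. The Fibonacci sequence is $F_0=0$, $F_1=1$, $F_{m+1}=F_m+F_{m-1}$. The entry point modulo $p$ is the least positive integer $e$ with $p\mid F_e$. Matrix congruences modulo $p$ are entrywise; $I_n$ is the identity matrix. *)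

(* Defs.v *)
From mathcomp Require Import all_boot all_order all_algebra.

Set Implicit Arguments.
Unset Strict Implicit.
Unset Printing Implicit Defensive.

Import GRing.Theory.
Local Open Scope ring_scope.

Fixpoint fib (m : nat) : nat :=
  match m with
  | 0 => 0
  | 1 => 1
  | (m'.+1 as m1).+1 => fib m1 + fib m'
  end%N.

Definition is_entry_point (p e : nat) : Prop :=
  [/\ (0 < e)%N, (p %| fib e)%N
    & forall m : nat, (0 < m)%N -> (p %| fib m)%N -> (e <= m)%N].

(* With 1-based indices the (i, j) entry is binom(i - 1, n - j); ordinals are
   0-based, so i - 1 becomes i and n - j becomes n - (j + 1).  The natural
   subtraction is never truncated because j < n. *)
Definition Rmx (n : nat) : 'M[int]_n :=
  \matrix_(i < n, j < n) ('C(i, n - j.+1))%:Z.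

Definition eqmx_mod (p m n : nat) (A B : 'M[int]_(m, n)) : Prop :=
  forall i j, (A i j = B i j %[mod p%:Z])%Z.

(* Main.v *)
(* Row i of R_{d+1} is the coefficient vector of (x + y)^i x^(d - i), so R_{d+1}
   is the substitution (x, y) -> (x + y, x) acting on the forms x^i y^(d - i) of
   degree d.  Its e-th power is therefore the substitution
   (x, y) -> (F_{e+1} x + F_e y, F_e x + F_{e-1} y).  When p divides F_e, we have
   F_{e+1} = F_{e-1} mod p and this is a homothety of ratio F_{e-1}, acting on
   forms of degree d as the scalar F_{e-1}^d; Cassini's identity gives
   F_{e-1}^2 = (-1)^e mod p. *)
Require Import Defs.
From mathcomp Require Import all_boot all_order all_algebra.
From mathcomp Require Import ring.

Local Open Scope ring_scope.
Import GRing.Theory.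

Lemma fibSS (m : nat) : fib m.+2 = (fib m.+1 + fib m)%N.
Proof. by []. Qed.

Arguments fib : simpl never.

Lemma fib_cassini (m : nat) :
  (fib m.+2)%:Z * (fib m)%:Z - (fib m.+1)%:Z ^+ 2 = (-1) ^+ m.+1.
Proof.
elim: m => [|m IHm]; first by [].
rewrite [RHS]exprS -IHm (fibSS m.+1) fibSS !PoszD; ring.
Qed.

Lemma Rmx_row_sum (A : comNzRingType) (d : nat) (i : 'I_d.+1) (x y : A) :
  \sum_(j < d.+1) (Rmx d.+1 i j)%:~R * (x ^+ j * y ^+ (d - j))
  = (x + y) ^+ i * x ^+ (d - i).
Proof.
have le_id : (i <= d)%N by rewrite -ltnS.
rewrite exprDn mulr_suml.
rewrite (big_ord_widen d.+1
  (fun j => x ^+ (i - j) * y ^+ j *+ 'C(i, j) * x ^+ (d - i))) //.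
(* Reversing [j] turns the entry into ['C(i, j)], aligned with the binomial expansion; the terms
   added for [j > i] vanish. *)
rewrite (reindex_inj rev_ord_inj) [RHS]big_mkcond /=.
apply: eq_bigr => j _; have le_jd : (j <= d)%N by rewrite -ltnS.
rewrite mxE /= !subSS !subKn //; case: ltnP => [le_ji | lt_ij]; last first.
  by rewrite bin_small // mul0r.
rewrite ltnS in le_ji.
have -> : (d - j = (i - j) + (d - i))%N by rewrite addnC addnBA // subnK.
by rewrite exprD -mulr_natl; ring.
Qed.

(** The exponent [m.+1] lets [fib m] stand for F_{e-1} without subtraction. *)
Lemma Rmx_exp_row_sum (A : comNzRingType) (d m : nat) (i : 'I_d.+1) (x y : A) :
  \sum_(j < d.+1) ((Rmx d.+1 ^+ m.+1) i j)%:~R * (x ^+ j * y ^+ (d - j))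
  = ((fib m.+2)%:R * x + (fib m.+1)%:R * y) ^+ i
    * ((fib m.+1)%:R * x + (fib m)%:R * y) ^+ (d - i).
Proof.
elim: m i => [|m IHm] i.
  by rewrite expr1 Rmx_row_sum !mul1r mul0r addr0.
rewrite exprS.
under eq_bigr => j _ do rewrite mxE rmorph_sum /= mulr_suml.
rewrite exchange_big /=.
under eq_bigr => k _.
  under eq_bigr => j _ do rewrite rmorphM /= -mulrA.
  rewrite -mulr_sumr IHm.
  over.
have fib_rec : (fib m.+2)%:R = (fib m.+1)%:R + (fib m)%:R :> A.
  by rewrite -natrD.
(* [Rmx_row_sum] is applied to the two linear forms from [IHm] in place of [x] and [y]. *)
by rewrite Rmx_row_sum (fibSS m.+1) natrD fib_rec; congr (_ ^+ _ * _); ring.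
Qed.

Lemma eqmx_mod_Fp (p : nat) (hp : prime p) (m n : nat) (M N : 'M[int]_(m, n)) :
  map_mx (intr : int -> 'F_p) M = map_mx intr N -> eqmx_mod p M N.
Proof.
move=> eqMN i j; apply/eqP; rewrite eqz_mod_dvd (dvdz_pcharf (pchar_Fp hp)).
move/matrixP/(_ i j): eqMN; rewrite !mxE rmorphB /= => ->.
by rewrite subrr.
Qed.

Lemma Rmx_exp_Fp (p : nat) (hp : prime p) (n e : nat) :
    (0 < n)%N -> (0 < e)%N -> (p %| fib e)%N ->
  map_mx (intr : int -> 'F_p) (Rmx n) ^+ e = ((fib (e - 1))%:R ^+ n.-1)%:M.
Proof.
case: n => // d _; case: e => // e _ p_fib; rewrite subn1 /=.
have fib0 : (fib e.+1)%:R = 0 :> 'F_p.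
  by apply/eqP; rewrite -(dvdn_pcharf (pchar_Fp hp)).
rewrite -rmorphXn; apply/matrixP=> i j; rewrite !mxE.
have le_id : (i <= d)%N by rewrite -ltnS.
(* Dehomogenise with x = 'X and y = 1: the coefficient of 'X^j is the entry (i, j), and the
   right-hand side collapses to F_e^d 'X^i. *)
have := @Rmx_exp_row_sum {poly 'F_p} d e i 'X 1.
rewrite fibSS natrD -!(rmorph_nat polyC) fib0 rmorph0 !add0r !mul0r addr0 !add0r mulr1.
rewrite exprMn mulrAC -exprD subnKC // -rmorphXn mul_polyC.
move/(congr1 (fun q : {poly 'F_p} => q`_j)); rewrite coefZ coefXn.
rewrite eq_sym mulr_natr => <-.
rewrite coef_sum (bigD1 j) //= big1 => [|k ne_kj].
  by rewrite -(rmorph_int polyC) mul_polyC coefZ expr1n mulr1 coefXn eqxx mulr1 addr0.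
rewrite -(rmorph_int polyC) mul_polyC coefZ expr1n mulr1 coefXn.
by rewrite eq_sym (inj_eq val_inj) (negbTE ne_kj) mulr0.
Qed.

Theorem theorem9 (p e : nat) (hp : prime p) (he : is_entry_point p e) :
  [/\ forall k : nat, (1 <= k)%N ->
        eqmx_mod p (Rmx (2 * k) ^+ e)
          ((-1) ^+ ((k + 1) * e) * (fib (e - 1))%:Z)%:M,
      forall k : nat,
        eqmx_mod p (Rmx (2 * k + 1) ^+ e) ((-1) ^+ (k * e))%:M
    & forall n : nat, (1 <= n)%N ->
        eqmx_mod p (Rmx n ^+ (4 * e)) 1%:M].
Proof.
case: he => e_gt0 p_fib _.
have fib_sqr : (fib (e - 1))%:R ^+ 2 = (-1) ^+ e :> 'F_p.
  case: e e_gt0 p_fib => // e _ p_fib; rewrite subn1 /=.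
  have fib0 : (fib e.+1)%:R = 0 :> 'F_p.
    by apply/eqP; rewrite -(dvdn_pcharf (pchar_Fp hp)).
  have := congr1 (intr : int -> 'F_p) (fib_cassini e).
  rewrite rmorphB rmorphM !rmorphXn rmorphN1 /= -!pmulrn fibSS natrD fib0.
  by rewrite add0r expr0n subr0.
split=> [k k_gt0|k|n n_gt0]; apply: eqmx_mod_Fp => //.
- rewrite rmorphXn Rmx_exp_Fp ?muln_gt0 // map_scalar_mx /=.
  congr (_%:M); rewrite rmorphM rmorphXn rmorphN1 /= -pmulrn.
  case: k k_gt0 => // k _.
  (* The degree 2k + 1 is odd, so one factor F_{e-1} survives; the sign exponents ke and (k + 2)e
     differ by the even number 2e. *)
  rewrite mulnS /= exprS exprM fib_sqr -exprM mulrC; congr (_ * _).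
  rewrite -addn1 -addnA mulnDl exprD [in RHS](mulnC 2) (exprM _ e 2) sqrr_sign mulr1.
  by rewrite mulnC.
- rewrite rmorphXn Rmx_exp_Fp ?addn1 // map_scalar_mx /=.
  congr (_%:M).
  by rewrite rmorphXn rmorphN1 exprM fib_sqr -exprM mulnC.
(* In any degree the fourth power is trivial, as F_{e-1}^4 = (-1)^(2e) = 1. *)
rewrite mulnC exprM 2!rmorphXn Rmx_exp_Fp // map_scalar_mx rmorph1 -rmorphXn.
by rewrite exprAC (exprM _ 2 2) fib_sqr sqrr_sign expr1n.
Qed.
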